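(* Let $n\ge 1$ and let $\mathcal{C}_n$ be the hyperplane arrangement in $\mathbb{R}^n$ consisting of the hyperplanes $$2x_i=-2,-1,0 \quad (1\le i\le n),\qquad x_i+x_j=-2,-1,0,\qquad x_i-x_j=-1,0,1 \quad (1\le i<j\le n).$$ Then the number of bounded regions of $\mathcal{C}_n$ is $$2^n\, n!\binom{2n-1}{n}.$$
   Context: A region of a finite arrangement $\mathcal{A}$ of affine hyperplanes in $\mathbb{R}^n$ is a connected component of $\mathbb{R}^n\setminus\bigcup\mathcal{A}$. A region is bounded if its intersection with the subspace spanned by the normal vectors to the hyperplanes is bounded. The notation $2x_i=-2,-1,0$ denotes three hyperplanes, one for each listed right-hand side (similarly for the others). $\mathcal{C}_n$ is the translate, by $X_i=x_i+\tfrac12$, of the type $C$ Catalan arrangement $2X_i=-1,0,1$; $X_i\pm X_j=-1,0,1$. *)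

(* Defs.v *)
From mathcomp Require Import all_boot all_order all_algebra.
From mathcomp Require Import all_classical all_reals all_analysis.

Set Implicit Arguments.
Unset Strict Implicit.
Unset Printing Implicit Defensive.

Import Order.TTheory GRing.Theory Num.Theory.
Import numFieldNormedType.Exports.

Local Open Scope classical_set_scope.
Local Open Scope ring_scope.

(* The pair (a, b), with a != 0, stands for the affine hyperplane a . x = b. *)
Definition arrangement (R : realType) (n : nat) : Type := seq ('rV[R]_n * R).

Definition hyperplane (R : realType) (n : nat) (h : 'rV[R]_n * R) :
    set 'rV[R]_n :=
  [set x | \sum_(k < n) h.1 0 k * x 0 k = h.2].

Definition complement (R : realType) (n : nat) (A : arrangement R n) :
    set 'rV[R]_n :=
  ~` \bigcup_(h in [set` A]) hyperplane h.

Definition region (R : realType) (n : nat) (A : arrangement R n)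
    (C : set 'rV[R]_n) : Prop :=
  exists2 x, complement A x & C = connected_component (complement A) x.

Definition normal_space (R : realType) (n : nat) (A : arrangement R n) :
    {vspace 'rV[R]_n} :=
  <<[seq h.1 | h <- A]>>%VS.

Definition bounded_region (R : realType) (n : nat) (A : arrangement R n)
    (C : set 'rV[R]_n) : Prop :=
  region A C /\ bounded_set (C `&` [set x | x \in normal_space A]).

Definition unit_row (R : realType) (n : nat) (i : 'I_n) : 'rV[R]_n :=
  delta_mx 0 i.

Definition ltpairs (n : nat) : seq ('I_n * 'I_n) :=
  [seq p : 'I_n * 'I_n <- enum {: 'I_n * 'I_n} | (p.1 < p.2)%N].

Definition catalanC (R : realType) (n : nat) : arrangement R n :=
  [seq (2 *: unit_row R i, c) | i <- enum 'I_n, c <- [:: -2; -1; 0 : R]]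
  ++ [seq (unit_row R p.1 + unit_row R p.2, c)
        | p <- ltpairs n, c <- [:: -2; -1; 0 : R]]
  ++ [seq (unit_row R p.1 - unit_row R p.2, c)
        | p <- ltpairs n, c <- [:: -1; 0; 1 : R]].

Lemma catalanC_normal_neq0 (R : realType) (n : nat) (h : 'rV[R]_n * R) :
  h \in catalanC R n -> h.1 != 0.
Proof.
have nz (u : 'rV[R]_n) i : u 0 i != 0 -> u != 0.
  by apply: contra_neq => ->; rewrite mxE.
rewrite !mem_cat => /or3P[] /allpairsP[[i c] /= [+ _ ->]] /=.
- by move=> _; apply: (nz _ i); rewrite !mxE !eqxx mulr1 pnatr_eq0.
- rewrite mem_filter => /andP[ij _]; apply: (nz _ i.1).
  by rewrite !mxE !eqxx /= -val_eqE /= ltn_eqF// addr0 oner_eq0.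
- rewrite mem_filter => /andP[ij _]; apply: (nz _ i.1).
  by rewrite !mxE !eqxx /= -val_eqE /= ltn_eqF// subr0 oner_eq0.
Qed.

Lemma catalanC_unionP (R : realType) (n : nat) (x : 'rV[R]_n) :
  (\bigcup_(h in [set` catalanC R n]) hyperplane h) x <->
  [\/ exists i, 2 * x 0 i \in [:: -2; -1; 0 : R],
      exists i j : 'I_n, (i < j)%N /\ x 0 i + x 0 j \in [:: -2; -1; 0 : R]
    | exists i j : 'I_n, (i < j)%N /\ x 0 i - x 0 j \in [:: -1; 0; 1 : R]].
Proof.
have dotu i : \sum_(k < n) unit_row R i 0 k * x 0 k = x 0 i.
  rewrite (bigD1 i)//= big1 => [|k ki]; first by rewrite mxE !eqxx mul1r addr0.
  by rewrite mxE (negPf ki) andbF mul0r.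
have dot2 i : \sum_(k < n) (2 *: unit_row R i) 0 k * x 0 k = 2 * x 0 i.
  by rewrite -dotu mulr_sumr; apply: eq_bigr => k _; rewrite mxE mulrA.
have dotD i j : \sum_(k < n) (unit_row R i + unit_row R j) 0 k * x 0 k
    = x 0 i + x 0 j.
  by rewrite -!dotu -big_split; apply: eq_bigr => k _; rewrite mxE mulrDl.
have dotB i j : \sum_(k < n) (unit_row R i - unit_row R j) 0 k * x 0 k
    = x 0 i - x 0 j.
  by rewrite -!dotu -sumrB; apply: eq_bigr => k _; rewrite !mxE mulrBl.
split=> [[h]|].
  rewrite /hyperplane /= !mem_cat.
  move=> /or3P[] /allpairsP[[p c] /= [+ cs ->]] /=.
  - by rewrite dot2 => _ e; apply: Or31; exists p; rewrite e.
  - rewrite dotD mem_filter => /andP[ij _] e.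
    by apply: Or32; exists p.1, p.2; rewrite e.
  - rewrite dotB mem_filter => /andP[ij _] e.
    by apply: Or33; exists p.1, p.2; rewrite e.
case=> [[i ci]|[i [j [ij cij]]]|[i [j [ij cij]]]].
- exists (2 *: unit_row R i, 2 * x 0 i); last exact: dot2.
  rewrite /= !mem_cat; apply/or3P/Or31.
  by apply/allpairsP; exists (i, 2 * x 0 i); rewrite mem_enum.
- exists (unit_row R i + unit_row R j, x 0 i + x 0 j); last exact: dotD.
  rewrite /= !mem_cat; apply/or3P/Or32.
  apply/allpairsP; exists ((i, j), x 0 i + x 0 j).
  by rewrite mem_filter mem_enum ij.
- exists (unit_row R i - unit_row R j, x 0 i - x 0 j); last exact: dotB.
  rewrite /= !mem_cat; apply/or3P/Or33.
  apply/allpairsP; exists ((i, j), x 0 i - x 0 j).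
  by rewrite mem_filter mem_enum ij.
Qed.

(* Main.v *)
(* After the translation X_i = x_i + 1/2, a region records the signs of the X_i,
   the order of the |X_i|, and how their sorted values y_0 < y_1 < ... < y_(n-1)
   interleave. It is bounded exactly when y_0 < 1/2 and every gap
   y_(k+1) - y_k is less than 1: otherwise all larger coordinates can be pushed to
   infinity. Let c_k be the number of elements of
   {1/2} u {y_i + 1, 1 - y_i | i < k} lying below y_k. These marks are ordered in
   the same way in all regions having the same signs of y_i - 1/2, and
   1/2 < y_k iff c_k > 0, so the word c determines the region in the chamber
   0 < y_0 < y_1 < ... Inserting the y_k one at a time shows that the words that
   occur are those with c_0 = 0 and c_k + [c_k > 0] <= c_(k+1) <= 2 (k + 1). They
   are counted by a ballot-type recursion, giving binom(2n - 1, n). *)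
Require Import Defs.
From mathcomp Require Import all_boot all_order all_algebra all_fingroup.
From mathcomp Require Import zify lra.

Set Implicit Arguments.
Unset Strict Implicit.
Unset Printing Implicit Defensive.

(** * Counting codes *)

(** Valid words of length [n.+1] with last letter [u]. The previous letter runs over [w < maxn 1 u]:
    zero may be repeated, every other step increases strictly. *)
Fixpoint codes (n u : nat) : seq (seq nat) :=
  if n is n'.+1 then
    if u <= n'.+1.*2 then
      [seq rcons c u | w <- iota 0 (maxn 1 u), c <- codes n' w]
    else [::]
  else if u == 0 then [:: [:: 0]] else [::].

Lemma codesS n u : codes n.+1 u =
  if u <= n.+1.*2 then
    [seq rcons c u | w <- iota 0 (maxn 1 u), c <- codes n w] else [::].
Proof. by []. Qed.

(* Adding [0 < c k] makes the word constant or increasing at 0 and strictly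
   increasing afterwards. *)
Definition is_code (c : nat -> nat) (n : nat) : Prop :=
  c 0 = 0 /\ forall k, k < n -> c k + (0 < c k) <= c k.+1 <= k.+1.*2.

Lemma codes_size n u s : s \in codes n u -> size s = n.+1.
Proof.
elim: n u s => [|n IH] u s /=; first by case: eqP => // _; rewrite inE => /eqP->.
case: ifP => // _ /allpairsPdep[w [c [_ /IH sz ->]]].
by rewrite size_rcons sz.
Qed.

Lemma mem_codes n u c :
  reflect (c n = u /\ is_code c n) (mkseq c n.+1 \in codes n u).
Proof.
apply: (iffP idP); elim: n u => [|n IH] u.
- rewrite /=; case: eqP => // ->; rewrite inE /mkseq /= => /eqP[c0].
  by split=> //; split.
- rewrite mkseqS codesS; case: ifP => // un /allpairsPdep[w [s [ws sw /rcons_inj[es cu]]]].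
  move: sw; rewrite -es.
  move=> /IH[cw [c0 cS]]; split=> //; split=> // k.
  rewrite ltnS leq_eqVlt => /orP[/eqP->|/cS//].
  by move: ws; rewrite mem_iota cw cu; lia.
- by case=> cu [c0 _]; rewrite -cu c0 /= /mkseq /= c0 inE.
- case=> cu [c0 cS]; rewrite mkseqS codesS.
  have := cS n (leqnn _); rewrite cu => /andP[h1 h2]; rewrite h2.
  apply/allpairsPdep; exists (c n), (mkseq c n.+1); split=> //.
    by rewrite mem_iota; lia.
  by apply: IH; split=> //; split=> // k kn; apply: cS; lia.
Qed.

(** The last letter separates the lists [codes n u], which makes the enumerations free of
    duplicates. *)
Lemma codes_last n u s : s \in codes n u -> last 0 s = u.
Proof.
case: n => [|n] /=; first by case: eqP => // ->; rewrite inE => /eqP->.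
by case: ifP => // _ /allpairsPdep[w [c [_ _ ->]]]; rewrite last_rcons.
Qed.

Lemma codes_uniq n u : uniq (codes n u).
Proof.
elim: n u => [|n IH] u /=; first by case: eqP.
case: ifP => // _; apply: allpairs_uniq_dep => //; first exact: iota_uniq.
move=> _ _ /allpairsPdep[w [c [_ cw ->]]] /allpairsPdep[w' [c' [_ cw' ->]]] /=.
move=> /rcons_inj[e]; move: cw cw'; rewrite e => /codes_last <- /codes_last <-.
by [].
Qed.

Lemma sum_bin_pascal v k :
  \sum_(j < k.+1) 'C(v.+1, j) = \sum_(j < k.+1) 'C(v, j) + \sum_(j < k) 'C(v, j).
Proof.
rewrite big_ord_recl [in RHS]big_ord_recl !bin0 -addnA -big_split /=.
by congr addn; apply: eq_bigr => j _; rewrite /bump /= add1n binS.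
Qed.

Arguments codes : simpl never.

(* Reflection principle for ballot words, by induction through Pascal's rule. *)
Lemma sum_size_codes n v : v <= n.*2 ->
  \sum_(w < v.+1) size (codes n w) + \sum_(j < v - n.+1) 'C(v, j)
  = \sum_(j < n.+1) 'C(v, j).
Proof.
elim: n v => [|n IH] v.
  by case: v => // _; rewrite !(big_ord_recl, big_ord0).
have size_codesS u : u <= n.*2.+2 ->
    size (codes n.+1 u) = \sum_(w < maxn 1 u) size (codes n w).
  move=> un; rewrite codesS doubleS un size_allpairs_dep sumnE big_map.
  by rewrite -(big_mkord xpredT (fun w => size (codes n w))) /index_iota subn0.
have topE : size (codes n n.*2.+1) = 0.
  by case: n {IH size_codesS} => // n; rewrite codesS ltnn.
elim: v => [|v IHv] vn.
  rewrite big_ord1 size_codesS // big_ord1 /= big_ord0.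
  have := IH 0 isT; rewrite big_ord1 big_ord0 !addn0 => ->.
  by rewrite !big_ord_recl !big1.
have {}IHv := IHv (ltnW vn).
rewrite big_ord_recr size_codesS /=; last by move: vn; rewrite doubleS.
rewrite (maxn_idPr _) // subSS.
(* [IH] stops at [n.*2], one short of the largest [v] here. At [v = n.*2.+1] the new summand
   vanishes by [topE], and the binomial differences for [n.*2] and [n.*2.+1] both equal
   ['C(n.*2.+1, n)]. *)
have {IH} IH : \sum_(w < v.+1) size (codes n w) + \sum_(j < v - n.+1) 'C(v, j)
    = \sum_(j < n.+1) 'C(v, j).
  have [/IH//|vn'] := leqP v n.*2.
  have {vn vn'} -> : v = n.*2.+1 by move: vn; rewrite doubleS; lia.
  rewrite big_ord_recr topE /= addn0.
  have := IH n.*2 (leqnn _).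
  have -> : n.*2.+1 - n.+1 = n by lia.
  case: n {IHv size_codesS topE IH} => [|n]; first by rewrite !(big_ord_recl, big_ord0).
  have -> : n.+1.*2 - n.+2 = n by lia.
  rewrite !sum_bin_pascal ![in \sum_(j < n.+2) _]big_ord_recr.
  rewrite ![in \sum_(j < n.+1) _]big_ord_recr /=; lia.
rewrite sum_bin_pascal.
case E : (v - n.+1) IH => [|k] IH.
  have e0 : v - n.+2 = 0 by lia.
  by move: IHv IH; rewrite e0 !big_ord0 !addn0 => <- <-.
have ek : v - n.+2 = k by lia.
move: IHv IH; rewrite sum_bin_pascal ek. by move=> <- <-; rewrite [X in _ + X = _]addnC addnACA.
Qed.

Definition all_codes (n : nat) : seq (seq nat) :=
  [seq s | u <- iota 0 n.*2.+1, s <- codes n u].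

Lemma mem_all_codes n c : reflect (is_code c n) (mkseq c n.+1 \in all_codes n).
Proof.
apply: (iffP allpairsPdep) => [[u [s [_ + e]]]|cP].
  by rewrite -e => /mem_codes[].
exists (c n), (mkseq c n.+1); split=> //; last exact/mem_codes.
rewrite mem_iota /= add0n ltnS; case: cP => c0 cS.
by case: n cS => [|n cS]; rewrite ?c0//; case/andP: (cS n (leqnn _)).
Qed.

Lemma all_codes_size n s : s \in all_codes n -> size s = n.+1.
Proof. by move=> /allpairsPdep[u [t [_ /codes_size <- ->]]]. Qed.

Lemma all_codes_uniq n : uniq (all_codes n).
Proof.
apply: allpairs_uniq_dep => //; first exact: iota_uniq.
  by move=> *; exact: codes_uniq.
move=> _ _ /allpairsPdep[w [c [_ cw ->]]] /allpairsPdep[w' [c' [_ cw' ->]]] /= e.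
by move: cw cw'; rewrite e => /codes_last <- /codes_last <-.
Qed.

(** At [v = n.*2] the ballot formula counts all words; for [n > 0] it leaves two adjacent binomials,
    combined by symmetry and Pascal's rule. *)
Lemma size_all_codes n : size (all_codes n) = 'C(n.*2.+1, n.+1).
Proof.
rewrite size_allpairs_dep sumnE big_map -[iota _ _]/(index_iota 0 n.*2.+1) big_mkord.
have := sum_size_codes (leqnn n.*2).
case: n => [|n]; first by rewrite !(big_ord_recl, big_ord0).
have -> : n.+1.*2 - n.+2 = n by lia.
rewrite !big_ord_recr /= binS.
have -> : 'C(n.+1.*2, n.+2) = 'C(n.+1.*2, n).
  by rewrite -bin_sub; [congr ('C(_, _)); lia|lia].
by lia.
Qed.

Import Order.TTheory GRing.Theory Num.Theory.
Local Open Scope ring_scope.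

(** * The dominant chamber *)

Lemma leq_count_sub (T : eqType) (a b : pred T) (s : seq T) :
  {in s, forall p, a p -> b p} -> (count a s <= count b s)%N.
Proof.
elim: s => // x s IH sub /=; apply: leq_add.
  by have := sub x (mem_head _ _); case: (a x) => // ->.
by apply: IH => p ps; apply: sub; rewrite inE ps orbT.
Qed.

Lemma eq_count_sub (T : eqType) (a b : pred T) (s : seq T) :
  {in s, forall p, a p -> b p} -> count a s = count b s ->
  {in s, forall p, a p = b p}.
Proof.
move=> sub e p ps; apply/idP/idP => [/(sub p ps)//|bp]; apply/negPn/negP => nap.
have /perm_to_rem/seq.permP cE := ps.
suff : (count a s < count b s)%N by rewrite e ltnn.
rewrite !cE /= (negPf nap) bp ltnS; apply: leq_count_sub => q /mem_rem.
exact: sub.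
Qed.

(* Two initial segments of the same size in the same total preorder agree. *)
Lemma eq_count_lt (R : realFieldType) (T : eqType) (s : seq T)
    (m m' : T -> R) (t t' : R) :
  {in s &, forall p q, (m p < m q) = (m' p < m' q)} ->
  count (fun p => m p < t) s = count (fun p => m' p < t') s ->
  {in s, forall p, (m p < t) = (m' p < t')}.
Proof.
move=> iso e.
(* If some [p] lies in the first segment only, the second is contained in the first; otherwise the
   first is contained in the second. Equal counts then suffice. *)
have [|/hasPn nh] := boolP (has (fun p => (m p < t) && ~~ (m' p < t')) s).
  case/hasP => p ps /andP[pt]; rewrite -leNgt => pt' q qs.
  apply/esym/(eq_count_sub _ (esym e) qs) => {qs}q qs qt'.
  have : m q < m p by rewrite iso//; exact: lt_le_trans pt'.
  by move=> /lt_trans; apply.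
apply: eq_count_sub e => p /nh; rewrite negb_and negbK.
by case: (m p < t).
Qed.

(** Each [x > a] in the list lowers the upper end of the interval from which [t] is taken. *)
Lemma just_above (R : realFieldType) (s : seq R) (a b : R) : a < b ->
  exists2 t, a < t < b & {in s, forall x, (x <= a) = (x <= t)}.
Proof.
elim: s b => [|x s IH] b ab; first by exists ((a + b) / 2) => //; lra.
have [|ax] := leP x a.
  case: (IH b ab) => t /andP[at' tb] ts xa; exists t; first by rewrite at' tb.
  move=> z; rewrite inE => /predU1P[->|/ts//].
  by apply/idP/idP; lra.
have : a < Num.min b x by rewrite lt_min ab ax.
case/IH => t; rewrite lt_min => /and3P[at' tb tx] ts.
exists t; first by rewrite at' tb.
by move=> z; rewrite inE => /predU1P[->|/ts//]; apply/idP/idP; lra.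
Qed.

Lemma exists_minimum (R : realFieldType) (s : seq R) : s != [::] ->
  exists2 q, q \in s & {in s, forall x, q <= x}.
Proof.
elim: s => // a s IH _; have [->|/IH[q qs qmin]] := eqVneq s [::].
  by exists a; rewrite ?mem_head// => x; rewrite inE => /eqP->.
have [aq|qa] := leP a q.
  exists a; first exact: mem_head.
  by move=> x; rewrite inE => /predU1P[->//|/qmin]; apply: le_trans.
exists q; first by rewrite inE qs orbT.
by move=> x; rewrite inE => /predU1P[->|/qmin//]; exact: ltW.
Qed.

(** A discrete intermediate value argument: without duplicates, [t] passes the elements of [s] one
    at a time, and each raises the count by one. *)
Lemma exists_count_lt (R : realFieldType) (s : seq R) (a b : R) (c : nat) :
  uniq s -> a < b ->
  (count (<= a) s <= c <= count (< b) s)%N ->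
  exists t, [/\ a < t < b, t \notin s & count (< t) s = c].
Proof.
move=> us ab /andP[]; have above q : a <= q < b ->
    exists t, [/\ a < t < b, t \notin s & count (< t) s = count (<= q) s].
  move=> /andP[aq qb]; case: (just_above s qb) => t /andP[qt tb] ts.
  exists t; split; first by rewrite tb andbT; lra.
    by apply/negP => /ts; rewrite lexx; lra.
  apply: eq_in_count => x xs /=; rewrite ts// lt_neqAle.
  have [xt|//] := eqVneq x t; have := ts x xs.
  by rewrite xt lexx; lra.
elim: c => [|c IH].
  by rewrite leqn0 => /eqP c0 _; rewrite -c0; apply: above; lra.
rewrite leq_eqVlt => /predU1P[<- _|]; first by apply: above; lra.
rewrite ltnS => /IH{}IH cb; case: (IH (ltnW cb)) => t [/andP[at' tb] ts tc].
have /hasP[z zs /andP[zb tz]] : has (fun z => (z < b) && (t <= z)) s.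
  apply/negPn/negP => /hasPn nh; suff : (count (< b) s <= c)%N by rewrite leqNgt cb.
  by rewrite -tc; apply: leq_count_sub => z /nh /=; rewrite negb_and -ltNge; case: (z < b).
(* [q] is the next element at or above [t]; a value just above [q] counts exactly one more. *)
have [q qs qmin] : exists2 q, (q \in s) && (t <= q) &
    {in s, forall x, t <= x -> q <= x}.
  have [|q] := @exists_minimum R [seq x <- s | t <= x].
    by apply/eqP => /(congr1 (fun r => z \in r)); rewrite mem_filter tz zs.
  rewrite mem_filter andbC => qs qmin; exists q => // x xs tx.
  by apply: qmin; rewrite mem_filter tx.
have /andP[{}qs tq] := qs; have qz := qmin z zs tz.
have [|u [uab us' uc]] := above q; first lra.
exists u; split=> //; rewrite uc -tc -addn1 -[X in (_ + X)%N](_ : count_mem q s = 1%N).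
  rewrite -count_predUI [X in (_ + X)%N](_ : _ = 0%N); last first.
    by apply/eqP; rewrite eqn0Ngt -has_count; apply/hasPn => x _ /=;
      apply/negP => /andP[xt /eqP xq]; move: xt; rewrite xq; lra.
  rewrite addn0; apply: eq_in_count => x xs /=; apply/idP/idP => [xq|/orP[|/eqP->]]; try lra.
  by have [//|tx] := ltP x t; rewrite eq_le xq qmin.
by rewrite count_uniq_mem// qs.
Qed.

Section Dominant.
Variable R : realFieldType.
Implicit Types (y : nat -> R) (t : R) (n k : nat).

(* [y 0 < ... < y n] are the absolute values of the coordinates [x_i + 1/2]; the
   upper bounds [y 0 < 1/2] and [y k.+1 < y k + 1] express boundedness. *)
Definition dominant y n : Prop :=
  [/\ 0 < y 0%N, y 0%N < 1 / 2,
      forall k, (k < n)%N -> y k < y k.+1 < y k + 1,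
      forall i j, (i <= j <= n)%N -> y i + y j != 1 &
      forall i j, (i <= j <= n)%N -> y i + 1 != y j].

(** Labels are kept apart from values so that the marks of two points can be compared label by
    label. *)
Fixpoint idx k : seq (option (nat * bool)) :=
  if k is k'.+1 then [:: Some (k', true), Some (k', false) & idx k']
  else [:: None].

(* The values a new largest coordinate must avoid. *)
Definition mark y (p : option (nat * bool)) : R :=
  match p with
  | None => 1 / 2
  | Some (i, true) => y i + 1
  | Some (i, false) => 1 - y i
  end.

(** At [t = y k] this is the letter c_k of the word. *)
Definition below y k t := count (fun p => mark y p < t) (idx k).

Lemma mem_idx i b k : (Some (i, b) \in idx k) = (i < k)%N.
Proof.
elim: k => // k IH; rewrite inE in_cons IH [RHS]leq_eqVlt eqSS orbA.
congr (_ || _); apply/idP/idP => [/orP[] /eqP[->]//|/eqP->].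
by case: (b); rewrite eqxx ?orbT.
Qed.

Lemma None_idx k : None \in idx k.
Proof. by elim: k => // k IH; rewrite !inE IH !orbT. Qed.

Lemma size_idx k : size (idx k) = k.*2.+1.
Proof. by elim: k => // k IH; rewrite /= IH doubleS. Qed.

Lemma dom_lt y n i j : dominant y n -> (i < j <= n)%N -> y i < y j.
Proof.
move=> [_ _ yS _ _] /andP[]; elim: j => // j IH.
rewrite ltnS leq_eqVlt => /predU1P[->|ij] jn; have /andP[h _] := yS j jn => //.
by apply: lt_trans h; apply: IH => //; exact: ltnW.
Qed.

Lemma dom_le y n i j : dominant y n -> (i <= j <= n)%N -> y i <= y j.
Proof.
move=> D /andP[]; rewrite leq_eqVlt => /predU1P[->//|ij jn].
by apply/ltW/(dom_lt D); rewrite ij.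
Qed.

Lemma dom_gt0 y n i : dominant y n -> (i <= n)%N -> 0 < y i.
Proof.
move=> D i_n; apply: (@lt_le_trans _ _ (y 0%N)); first by case: D.
exact: (dom_le D).
Qed.

(** [None] is the mark [1 / 2] itself. Any other mark below [y k] also forces [1 / 2 < y k]: for
    instance [1 - y i < y k] and [y i < y k] add up to [1 < y k + y k]. *)
Lemma below_gt0 y n k : dominant y n -> (k <= n)%N ->
  (0 < below y k (y k))%N = (1 / 2 < y k).
Proof.
move=> D kn; rewrite /below -has_count; apply/hasP/idP => [|yk]; last first.
  by exists None; first exact: None_idx.
case=> -[[i b]|]//; rewrite mem_idx => ik /=.
have := dom_gt0 D (leq_trans (ltnW ik) kn).
have : y i < y k by apply: (dom_lt D); rewrite ik.
by case: b; lra.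
Qed.

Lemma belowS y k t :
  below y k.+1 t = ((y k + 1 < t)%R + ((1 - y k < t)%R + below y k t))%N.
Proof. by []. Qed.

(** Step [k] adds two marks: [y k + 1], never below [y k.+1] by boundedness, and [1 - y k], below it
    as soon as [1 / 2 < y k]. Leaving out the former gives the upper bound. *)
Lemma below_code y n : dominant y n -> is_code (fun k => below y k (y k)) n.
Proof.
move=> D; have [y0 y02 yS _ _] := D; split=> [|k kn].
  by apply/eqP; rewrite -leqn0 leqNgt (below_gt0 D)// -leNgt ltW.
have /andP[lt1 lt2] := yS k kn.
rewrite (below_gt0 D) ?(ltnW kn)// belowS.
rewrite (_ : (y k + 1 < y k.+1)%R = false) ?add0n; last by rewrite ltNge ltW.
apply/andP; split.
  rewrite addnC; apply: leq_add.
    by have [h|//] := ltP (1/2) (y k); rewrite (_ : _ < _)%R//; lra.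
  by apply: leq_count_sub => p _ /lt_trans; apply.
by rewrite doubleS; apply: leq_add (leq_b1 _) _; rewrite -size_idx count_size.
Qed.

(** The order of the marks depends only on the order of the [y i] and on which of them exceed
    [1 / 2]; the words show the latter. So [eq_count_lt] applies. *)
Lemma below_inj y y' n : dominant y n -> dominant y' n ->
  (forall k, (k <= n)%N -> below y k (y k) = below y' k (y' k)) ->
  forall k, (k <= n)%N -> {in idx k, forall p, (mark y p < y k) = (mark y' p < y' k)}.
Proof.
move=> D D' e k kn; apply: eq_count_lt; last exact: e.
have half i : (i <= n)%N -> (1 / 2 < y i) = (1 / 2 < y' i).
  by move=> i_n; rewrite -(below_gt0 D)// -(below_gt0 D')// e.
have ylt i j : (i <= n)%N -> (j <= n)%N -> (y i < y j) = (y' i < y' j).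
  move=> i_n jn; case: (ltngtP i j) => [ij|ji|->]; last by rewrite !ltxx.
    by rewrite (dom_lt D) ?(dom_lt D')// ij.
  by rewrite !ltNge !ltW// ?(dom_lt D) ?(dom_lt D')// ji.
have hne z : dominant z n -> forall i, (i <= n)%N -> z i != 1 / 2.
  move=> [_ _ _ h _] i i_n; have := h i i; rewrite leqnn i_n => /(_ isT).
  by apply: contra_neq => ->; lra.
have hlt i : (i <= n)%N -> (1 / 2 < y i /\ 1 / 2 < y' i) \/ (y i < 1 / 2 /\ y' i < 1 / 2).
  move=> i_n; have := hne y D i i_n; have := hne y' D' i i_n; have := half i i_n.
  rewrite !neq_lt; case: (ltrP (1 / 2) (y i)) => h /esym h' /orP[] ? /orP[] ?;
    (by left; lra) || (by right; lra).
have gt0 i : (i <= n)%N -> 0 < y i /\ 0 < y' i.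
  by move=> i_n; split; [apply: (dom_gt0 D)|apply: (dom_gt0 D')].
have le_n i : (i < k)%N -> (i <= n)%N by move=> ik; exact: leq_trans (ltnW ik) kn.
move=> [[i b]|] [[j c]|]; rewrite ?mem_idx => /=; last by rewrite !ltxx.
- move=> /le_n i_n /le_n jn; have [? ?] := gt0 _ i_n; have [? ?] := gt0 _ jn.
  have e1 := ylt i j i_n jn; have e2 := ylt j i jn i_n.
  case: (hlt _ i_n) => -[? ?]; case: (hlt _ jn) => -[? ?];
  case: b; case: c; rewrite ?ltrD2r ?ltrD2l ?ltrN2 //; apply/idP/idP; lra.
- move=> /le_n i_n _; have [? ?] := gt0 _ i_n.
  by case: b; case: (hlt _ i_n) => -[? ?]; apply/idP/idP; lra.
- move=> _ /le_n i_n; have [? ?] := gt0 _ i_n.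
  by case: c; case: (hlt _ i_n) => -[? ?]; apply/idP/idP; lra.
Qed.

Lemma eq_mark y y' k : (forall i, (i < k)%N -> y i = y' i) ->
  {in idx k, mark y =1 mark y'}.
Proof. by move=> e [[i [] /[!mem_idx] /e /= ->]|_]. Qed.

(** [k] may reach [n.+1], since a new coordinate is inserted against all marks of [idx n.+1]. *)
Lemma mark_uniq y n k : dominant y n -> (k <= n.+1)%N -> uniq (map (mark y) (idx k)).
Proof.
move=> D kn; rewrite map_inj_in_uniq; last first.
  have [_ _ _ Hs _] := D.
  have hne i : (i < k)%N -> y i != 1 / 2.
    move=> ik; have := Hs i i; rewrite leqnn -ltnS (leq_trans ik kn) => /(_ isT).
    by apply: contra_neq => ->; lra.
  have inj i j : (i < k)%N -> (j < k)%N -> y i = y j -> i = j.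
    move=> ik jk; case: (ltngtP i j) => // ij.
      have : y i < y j by apply: (dom_lt D); rewrite ij -ltnS (leq_trans jk).
      by move=> /[swap] ->; rewrite ltxx.
    have : y j < y i by apply: (dom_lt D); rewrite ij -ltnS (leq_trans ik).
    by move=> /[swap] ->; rewrite ltxx.
  have gt0 i : (i < k)%N -> 0 < y i.
    by move=> ik; apply: (dom_gt0 D); rewrite -ltnS (leq_trans ik).
  move=> [[i b]|] [[j c]|]; rewrite ?mem_idx => //=.
  - move=> ik jk; have := gt0 _ ik; have := gt0 _ jk.
    by case: b; case: c => ? ? e; (by exfalso; lra) ||
      by congr (Some (_, _)); apply: inj => //; lra.
  - move=> ik _; have := gt0 _ ik; have /eqP := hne _ ik.
    by case: b => ? ? ?; exfalso; lra.
  - move=> _ ik; have := gt0 _ ik; have /eqP := hne _ ik.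
    by case: c => ? ? ?; exfalso; lra.
elim: k {kn} => // k IH; rewrite /= !inE negb_or !mem_idx ltnn IH !andbT /=.
by apply/eqP => -[].
Qed.

(** The next value is placed between [y n] and [y n + 1] by [exists_count_lt]; the two inequalities
    of [is_code] bound the letter by the counts at these ends. *)
Lemma code_realizable (c : nat -> nat) n : is_code c n ->
  exists2 y, dominant y n & forall k, (k <= n)%N -> below y k (y k) = c k.
Proof.
elim: n => [|n IH] [c0 cS].
  exists (fun=> 1 / 4).
    by split=> [|||i j _|i j _]; rewrite ?neq_lt //; lra.
  by move=> k; rewrite leqn0 => /eqP->; rewrite /below /= c0 ltNge;
    have -> : 1 / 4 <= 1 / 2 :> R by lra.
have [|y D yc] := IH; first by split=> // k kn; apply: cS; exact: ltnW.
have [y0 y02 yS Hs Hd] := D.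
have /andP[cn1 cn2] := cS n (leqnn _).
have [||t [/andP[t1 t2] tm tc]] := @exists_count_lt R (map (mark y) (idx n.+1))
   (y n) (y n + 1) (c n.+1) (mark_uniq D (leqnn _)).
- lra.
- rewrite !count_map; apply/andP; split.
    (* No mark equals [y n], so those at most [y n] are the ones counted by [c n], together with
       [1 - y n] when [1 / 2 < y n]. *)
    apply: leq_trans cn1; rewrite -(yc n (leqnn _)) (below_gt0 D)// addnC.
    rewrite /= (_ : (y n + 1 <= y n) = false) ?add0n; last by apply/negP; lra.
    apply: leq_add; last first.
      apply: leq_count_sub => p pn /=; rewrite le_eqVlt => /predU1P[pe|//].
      case: p pn pe => [[i b]|_ /= ye]; last first.
        have := Hs n n; rewrite leqnn => /(_ isT) /eqP[]; lra.
      rewrite mem_idx => /ltnW i_n.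
      have := Hs i n; have := Hd i n; rewrite i_n leqnn.
      by case: b => /= /(_ isT) /eqP h1 /(_ isT) /eqP h2 ?; [case: h1|case: h2]; lra.
    have := Hs n n; rewrite leqnn => /(_ isT); rewrite neq_lt => /orP[] ?.
      by rewrite leNgt (_ : y n < 1 - y n) //=; lra.
    by rewrite (_ : 1 / 2 < y n) ?leq_b1//; lra.
  (* At the upper end every mark except [y n + 1] itself is counted. *)
  apply: leq_trans cn2 _; rewrite /= ltxx add0n (_ : 1 - y n < y n + 1); last first.
    by have := dom_gt0 D (leqnn n); lra.
  rewrite doubleS add1n ltnS -size_idx leq_eqVlt eq_sym -all_count.
  apply/orP; left; apply/allP => -[[i b]|_] /=; last by have := dom_gt0 D (leqnn n); lra.
  rewrite mem_idx => i_n.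
  have : y i < y n by apply: (dom_lt D); rewrite i_n /=.
  by have := dom_gt0 D (ltnW i_n); case: b; lra.
pose z k := if k == n.+1 then t else y k.
have zE k : (k <= n)%N -> z k = y k by rewrite /z => kn; case: eqP => // kE; lia.
have zn : z n.+1 = t by rewrite /z eqxx.
have tne p : p \in idx n.+1 -> mark y p != t.
  by move=> pn; apply: contraNneq tm => <-; exact: map_f.
have t12 : 1 / 2 != t by exact: (tne None (None_idx _)).
have t0 : 0 < t by have := dom_gt0 D (leqnn n); lra.
exists z.
  split=> [|||i j|i j]; [by rewrite zE|by rewrite zE| | |].
  - move=> k; rewrite ltnS leq_eqVlt => /predU1P[->|kn]; last first.
      by rewrite !zE ?yS// ltnW.
    by rewrite zn zE// t1 t2.
  - move=> /andP[ij]; rewrite leq_eqVlt => /predU1P[jE|jn]; last first.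
      by rewrite !zE ?Hs ?ij ?(leq_trans ij)//.
    move: ij; rewrite jE zn leq_eqVlt => /predU1P[->|i_n].
      by rewrite zn; apply: contraNneq t12; lra.
    rewrite zE//; have := tne (Some (i, false)).
    by rewrite mem_idx => /(_ i_n); apply: contraNneq => /=; lra.
  - move=> /andP[ij]; rewrite leq_eqVlt => /predU1P[jE|jn]; last first.
      by rewrite !zE ?Hd ?ij ?(leq_trans ij)//.
    move: ij; rewrite jE zn leq_eqVlt => /predU1P[->|i_n].
      by rewrite zn; apply/eqP; lra.
    by rewrite zE//; have := tne (Some (i, true)); rewrite mem_idx => /(_ i_n).
move=> k; rewrite leq_eqVlt => /predU1P[->|].
  rewrite zn -tc count_map; apply: eq_in_count => p pn /=.
  by rewrite (@eq_mark z y n.+1).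
rewrite ltnS => kn; rewrite zE// -yc//; apply: eq_in_count => p pn /=.
by rewrite (@eq_mark z y k)// => i ik; apply: zE; lia.
Qed.

End Dominant.

(** * Signed points *)

(** The value [s i] is the number of [j] with [s j < s i]. *)
Lemma perm_ltn_inj n (s s' : {perm 'I_n}) :
  (forall i j, (s i < s j)%N = (s' i < s' j)%N) -> s = s'.
Proof.
move=> e; apply/permP => i; apply/val_inj => /=.
have cE (t : {perm 'I_n}) : #|[set j | (t j < t i)%N]| = t i.
  have -> : [set j | (t j < t i)%N] = t @^-1: [set k : 'I_n | (k < t i)%N].
    by apply/setP => j; rewrite !inE.
  rewrite card_preimset; last exact: perm_inj.
  by rewrite cardsE -sum1_card -(big_ord_widen n (fun=> 1%N)) 1?ltnW// sum1_card card_ord.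
by rewrite -(cE s) -(cE s'); apply: eq_card => j; rewrite !inE e.
Qed.

(** [s i] is the number of indices with a value smaller than [p i]. *)
Lemma rank_perm (R : realFieldType) n (p : 'I_n -> R) : injective p ->
  exists s : {perm 'I_n}, forall i j, (s i < s j)%N = (p i < p j).
Proof.
move=> inj.
have rkP i : (#|[set j | (p j < p i)%R]| < n)%N.
  rewrite -[X in (_ < X)%N]card_ord -cardsT; apply: proper_card.
  by apply/properP; split=> //; exists i; rewrite ?inE ?ltxx.
pose rk i := Ordinal (rkP i).
have lt i j : p i < p j -> (rk i < rk j)%N.
  move=> ij; apply: proper_card; apply/properP; split.
    by apply/subsetP => k; rewrite !inE => /lt_trans; apply.
  by exists i; rewrite inE ?ltxx.
have rk_inj : injective rk.
  move=> i j e; case: (ltgtP (p i) (p j)) => [/lt|/lt|/inj//]; by rewrite e ltnn.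
exists (perm rk_inj) => i j; rewrite !permE.
case: (ltgtP (p i) (p j)) => [/lt//|/lt ji|/inj->]; last exact: ltnn.
by rewrite ltnNge ltnW.
Qed.

(** Transports an equality of comparisons along rearrangements of the inequalities that [lra] can
    prove. *)
Lemma eq_lt_iff (R : numDomainType) (x y z t x' y' z' t' : R) :
  (x < y) = (z < t) -> (x < y <-> x' < y') -> (z < t <-> z' < t') ->
  (x' < y') = (z' < t').
Proof.
by move=> e xx zz; apply/idP/idP => [/xx|/zz]; [rewrite e => /zz|rewrite -e => /xx].
Qed.

Section SignedPoints.
Variables (R : realFieldType) (n : nat).
Implicit Types (u v p q : 'I_n.+1 -> R) (i j : 'I_n.+1).

(** A bit [true] is a minus sign; [i = j] with equal bits gives twice a coordinate up to sign. *)
Definition sform u i j (a b : bool) : R := (-1) ^+ a * u i + (-1) ^+ b * u j.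

(* The condition [(i != j) || (a == b)] only excludes [u i - u i], so these are
   all the hyperplanes of the Catalan arrangement of type C. *)
Definition generic u : Prop := forall i j a b c,
  c \in [:: -1; 0; 1] -> (i != j) || (a == b) -> sform u i j a b != c.

Definition alike u v : Prop := forall i j a b c,
  c \in [:: -1; 0; 1] -> (sform u i j a b < c) = (sform v i j a b < c).

Definition absf u i : R := `|u i|.

Lemma sform_abs u i j a b :
  sform u i j a b = sform (absf u) i j (a (+) (u i < 0)) (b (+) (u j < 0)).
Proof.
by rewrite /sform /absf !signr_addb -!mulrA -!numEsign.
Qed.

Lemma alike_sym u v : alike u v -> alike v u.
Proof. by move=> uv i j a b c cP; rewrite uv. Qed.

Lemma alike_sign u v i : alike u v -> (u i < 0) = (v i < 0).
Proof.
move=> /(_ i i false false 0); rewrite /sform !expr0 !mul1r !inE eqxx orbT => /(_ isT) e.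
by apply/idP/idP => h; move: e; [have -> : u i + u i < 0 by lra|have -> : v i + v i < 0 by lra]; lra.
Qed.

(** For positive coordinates a form either has a known position relative to the level or amounts to
    one of these comparisons, possibly reversed; genericity excludes equality, so the reversed ones
    agree too. *)
Lemma pos_alike p q :
  (forall i, 0 < p i) -> (forall i, 0 < q i) -> generic p -> generic q ->
  (forall i j, (p i < p j) = (q i < q j)) ->
  (forall i j, (p i + 1 < p j) = (q i + 1 < q j)) ->
  (forall i j, (1 - p i < p j) = (1 - q i < q j)) ->
  alike p q.
Proof.
move=> p0 q0 gp gq e0 e1 e2.
have ne x : generic x -> forall i j, x i + x j != 1.
  move=> gx i j; have := gx i j false false 1.
  by rewrite /sform !mul1r !inE !eqxx !orbT; apply.
have ne1 x : generic x -> forall i j, i != j -> x i + 1 != x j.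
  move=> gx i j ij; have := gx i j false true (-1).
  rewrite /sform expr0 expr1 mul1r !inE eqxx ij => /(_ isT isT).
  by apply: contra_neq; lra.
have E2 i j : (p i + p j < 1) = (q i + q j < 1).
  have := ne _ gp i j; have := ne _ gq i j; have := e2 i j.
  by rewrite !neq_lt; case: ltP => ? /esym; case: ltP => ? // _ /orP[] ? /orP[] ?; apply/idP/idP; lra.
have E1 i j : i != j -> (p j < p i + 1) = (q j < q i + 1).
  move=> ij; have := ne1 _ gp i j ij; have := ne1 _ gq i j ij; have := e1 i j.
  by rewrite !neq_lt; case: ltP => ? /esym; case: ltP => ? // _ /orP[] ? /orP[] ?; apply/idP/idP; lra.
move=> i j a b c; rewrite /sform !inE => cP.
have := p0 i; have := p0 j; have := q0 i; have := q0 j => ? ? ? ?.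
have [ij|ij] := eqVneq i j.
  rewrite ij in cP *; case/or3P: cP => /eqP->; case: a; case: b; rewrite ?expr0 ?expr1 ?mul1r ?mulN1r;
    first [by apply/idP/idP; lra | by apply: (eq_lt_iff (e2 j j)); lra | idtac].
  by rewrite E2.
have ji : j != i by rewrite eq_sym.
case/or3P: cP => /eqP->; case: a; case: b; rewrite ?expr0 ?expr1 ?mul1r ?mulN1r;
  first [ by apply/idP/idP; lra | by apply: (eq_lt_iff (e2 i j)); lra
        | by apply: (eq_lt_iff (e0 i j)); lra | by apply: (eq_lt_iff (e0 j i)); lra
        | by apply: (eq_lt_iff (e1 i j)); lra | by apply: (eq_lt_iff (e1 j i)); lra
        | by apply: (eq_lt_iff (E1 i j ij)); lra | by apply: (eq_lt_iff (E1 j i ji)); lra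
        | exact: E2].
Qed.

Lemma generic_abs u : generic u -> generic (absf u).
Proof.
move=> gu i j a b c cP ab; have := gu i j (a (+) (u i < 0)) (b (+) (u j < 0)) c cP.
rewrite sform_abs -!addbA !addbb !addbF; apply.
by case: eqVneq ab => [->|]//= /eqP->.
Qed.

Lemma alike_abs u v : alike u v -> alike (absf u) (absf v).
Proof.
move=> uv i j a b c cP; have := uv i j (a (+) (u i < 0)) (b (+) (u j < 0)) c cP.
rewrite (sform_abs u) (sform_abs v) -!(alike_sign _ uv).
by rewrite -!addbA !addbb !addbF.
Qed.

Lemma abs_alike u v : (forall i, (u i < 0) = (v i < 0)) ->
  alike (absf u) (absf v) -> alike u v.
Proof. by move=> e uv i j a b c cP; rewrite (sform_abs u) (sform_abs v) !e uv. Qed.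

Lemma generic_neq0 u i : generic u -> u i != 0.
Proof.
move=> gu; have := gu i i false false 0.
rewrite /sform !mul1r !inE !eqxx !orbT => /(_ isT isT).
by apply: contra_neq => ->; rewrite addr0.
Qed.

Lemma generic_inj u : generic u -> injective u.
Proof.
move=> gu i j e; apply/eqP/negPn/negP => ij; have := gu i j false true 0.
by rewrite /sform expr0 expr1 mul1r mulN1r e subrr !inE eqxx ij orbT => /(_ isT isT).
Qed.

Lemma absf_gt0 u i : generic u -> 0 < absf u i.
Proof. by move=> gu; rewrite normr_gt0 generic_neq0. Qed.

(* The coordinates indexed by [J] can be moved away from the origin without
   crossing a hyperplane; no such [J] exists exactly in a bounded region. *)
Definition escape u (J : {set 'I_n.+1}) : Prop :=
  [/\ J != set0, {in J, forall i, 1 < absf u i + absf u i} &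
      forall i j, i \in J -> j \notin J -> absf u j + 1 < absf u i].

Definition push u (J : {set 'I_n.+1}) (t : R) i : R :=
  (-1) ^+ (u i < 0)%R * (absf u i + (if i \in J then t else 0)).

Lemma alike_pos p q i j : alike p q ->
  [/\ (p i < p j) = (q i < q j), (p i + 1 < p j) = (q i + 1 < q j) &
      (1 - p i < p j) = (1 - q i < q j)].
Proof.
move=> pq; split.
- have := pq i j false true 0; rewrite /sform !inE eqxx orbT => /(_ isT) e.
  by apply: (eq_lt_iff e); rewrite expr0 expr1 mul1r mulN1r; lra.
- have := pq i j false true (-1); rewrite /sform !inE eqxx => /(_ isT) e.
  by apply: (eq_lt_iff e); rewrite expr0 expr1 mul1r mulN1r; lra.
- have := pq i j true true (-1); rewrite /sform !inE eqxx => /(_ isT) e.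
  by apply: (eq_lt_iff e); rewrite expr1 !mulN1r; lra.
Qed.

Lemma push_abs u J t i : generic u -> 0 <= t ->
  (push u J t i < 0) = (u i < 0) /\ absf (push u J t) i = absf u i + (if i \in J then t else 0).
Proof.
move=> gu t0; have := absf_gt0 i gu.
have : 0 <= (if i \in J then t else 0) by case: ifP.
rewrite /push {3}/absf normrM normr_sign mul1r.
move: (absf u i) (if _ then _ else _) => a b b0 a0.
rewrite ger0_norm; last lra; split=> //.
by case: (u i < 0); rewrite ?expr0 ?expr1 ?mul1r ?mulN1r; apply/idP/idP; lra.
Qed.

(** A form with exactly one index in [J], or with both in [J] and equal signs, exceeds 1 in absolute
    value and only moves further out; the other forms do not change. *)
Lemma push_side u J t i j a b c : generic u -> escape u J -> 0 <= t ->
  c \in [:: -1; 0; 1] -> (i != j) || (a == b) ->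
  let f := sform (absf u) i j a b in let f' := sform (absf (push u J t)) i j a b in
  (f < c /\ f' < c) \/ (c < f /\ c < f').
Proof.
move=> gu [_ J1 J2] t0 cP ab /=.
have := generic_abs gu cP ab; have := absf_gt0 i gu; have := absf_gt0 j gu.
have := J1 i; have := J1 j; have := J2 i j; have := J2 j i.
rewrite /sform (push_abs J i gu t0).2 (push_abs J j gu t0).2 neq_lt.
move: (absf u i) (absf u j) => x y.
case: (i \in J); case: (j \in J) => Jji Jij Jj Ji.
- have {}Ji := Ji isT; have {}Jj := Jj isT => ? ?.
  move: cP; rewrite !inE => /or3P[] /eqP-> /orP[]; case: a {ab}; case: b;
  rewrite ?expr0 ?expr1 ?mul1r ?mulN1r => ?; (by left; lra) || (by right; lra).
- have {}Jij := Jij isT isT => ? ?.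
  move: cP; rewrite !inE => /or3P[] /eqP-> /orP[]; case: a {ab}; case: b;
  rewrite ?expr0 ?expr1 ?mul1r ?mulN1r => ?; (by left; lra) || (by right; lra).
- have {}Jji := Jji isT isT => ? ?.
  move: cP; rewrite !inE => /or3P[] /eqP-> /orP[]; case: a {ab}; case: b;
  rewrite ?expr0 ?expr1 ?mul1r ?mulN1r => ?; (by left; lra) || (by right; lra).
- by rewrite !addr0 => _ _ /orP[] ?; [left|right].
Qed.

Lemma push_generic u J t : generic u -> escape u J -> 0 <= t -> generic (push u J t).
Proof.
move=> gu eJ t0 i j a b c cP ab; rewrite sform_abs.
set a' := a (+) _; set b' := b (+) _.
have ab' : (i != j) || (a' == b').
  by rewrite /a' /b'; case: eqVneq ab => [->|]//= /eqP->.
by rewrite neq_lt; case: (push_side gu eJ t0 cP ab') => -[_ ->]; rewrite ?orbT.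
Qed.

Lemma push_alike u J t : generic u -> escape u J -> 0 <= t -> alike u (push u J t).
Proof.
move=> gu eJ t0; apply: abs_alike => [i|i j a b c cP].
  by rewrite (push_abs J i gu t0).1.
have [ab|] := boolP ((i != j) || (a == b)).
  case: (push_side gu eJ t0 cP ab) => -[h h']; first by rewrite h h'.
  by rewrite !ltNge !ltW.
rewrite negb_or negbK => /andP[/eqP-> ab]; rewrite /sform.
by case: a ab; case: b => // _; rewrite ?expr0 ?expr1 !mul1r !mulN1r ?subrr ?addNr.
Qed.

Lemma escape_alike u v J : alike u v -> escape u J -> escape v J.
Proof.
move=> /alike_abs uv [J0 J1 J2]; split=> // [i iJ|i j iJ jJ].
  have [_ _ e] := alike_pos i i uv; have := J1 i iJ.
  by move=> h; have : 1 - absf u i < absf u i by [lra]; rewrite e; lra.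
by have [_ <- _] := alike_pos j i uv; exact: J2.
Qed.

(** * Codes of points *)

Definition signed_code : Type := {perm 'I_n.+1} * {ffun 'I_n.+1 -> bool} * seq nat.

(** [y] lists the sorted absolute values, [d.1.1 i] is the rank of [u i] among them, and a [true]
    bit marks a negative coordinate. Boundedness is built in through [dominant]. *)
Definition has_code u (d : signed_code) : Prop :=
  exists y, [/\ dominant y n, forall i, u i = (-1) ^+ d.1.2 i * y (d.1.1 i) &
    d.2 = mkseq (fun k => below y k (y k)) n.+1].

Lemma has_code_abs u (d : signed_code) y : dominant y n ->
  (forall i, u i = (-1) ^+ d.1.2 i * y (d.1.1 i)) ->
  forall i, (u i < 0) = d.1.2 i /\ absf u i = y (d.1.1 i).
Proof.
move=> D uE i; have := dom_gt0 D (ltn_ord (d.1.1 i)); rewrite /absf uE normrM normr_sign mul1r.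
move: (y _) => z z0; rewrite gtr0_norm//; split=> //.
by case: (d.1.2 i); rewrite ?expr0 ?expr1 ?mul1r ?mulN1r; apply/idP/idP; lra.
Qed.

(** [below_inj] covers the marks of smaller index. For [l < k] the condition on the sum is
    symmetric, and for [k = l] it reduces to the mark [1 / 2]. *)
Lemma dominant_compare (y y' : nat -> R) k l : dominant y n -> dominant y' n ->
  (forall k, (k <= n)%N -> below y k (y k) = below y' k (y' k)) ->
  (k <= n)%N -> (l <= n)%N ->
  [/\ (y k < y l) = (y' k < y' l), (y k + 1 < y l) = (y' k + 1 < y' l) &
      (1 - y k < y l) = (1 - y' k < y' l)].
Proof.
move=> D D' e kn ln; have B := below_inj D D' e.
case: (ltngtP k l) => [kl|lk|<-].
- rewrite (dom_lt D) ?(dom_lt D') ?kl//; split=> //.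
    by have := B l ln (Some (k, true)); rewrite mem_idx => /(_ kl).
  by have := B l ln (Some (k, false)); rewrite mem_idx => /(_ kl).
- have h : y l < y k by rewrite (dom_lt D) ?lk.
  have h' : y' l < y' k by rewrite (dom_lt D') ?lk.
  split; [by apply/idP/idP; lra|by apply/idP/idP; lra|].
  have := B k kn (Some (l, false)); rewrite mem_idx => /(_ lk) /= el.
  by apply: (eq_lt_iff el); lra.
- rewrite !ltxx; split=> //; first by apply/idP/idP; lra.
  have := B k kn None (None_idx _) => /= el.
  by apply: (eq_lt_iff el); lra.
Qed.

Lemma has_code_alike u v d : generic u -> generic v ->
  has_code u d -> has_code v d -> alike u v.
Proof.
move=> gu gv [y [D uE cE]] [y' [D' vE]]; rewrite cE => e.
have ue := has_code_abs D uE; have ve := has_code_abs D' vE.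
apply: abs_alike => [i|]; first by rewrite (ue i).1 (ve i).1.
have {}e k : (k <= n)%N -> below y k (y k) = below y' k (y' k).
  by move=> kn; have := congr1 (fun s => nth 0%N s k) e; rewrite !nth_mkseq.
have C i j := dominant_compare D D' e (ltn_ord (d.1.1 i)) (ltn_ord (d.1.1 j)).
apply: pos_alike; try exact: generic_abs; try by move=> i; exact: absf_gt0.
all: by move=> i j; rewrite !(ue _).2 !(ve _).2; case: (C i j).
Qed.

(** Signs and ranks are read off the forms, and each letter counts comparisons that are themselves
    given by forms. *)
Lemma alike_has_code u v d d' : generic u -> generic v -> alike u v ->
  has_code u d -> has_code v d' -> d = d'.
Proof.
case: d d' => [[s f] c] [[s' f'] c'] gu gv uv [y [D uE /= ->]] [y' [D' vE /= ->]].
have ue := has_code_abs D uE; have ve := has_code_abs D' vE.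
have C i j := alike_pos i j (alike_abs uv).
have yle (y0 : nat -> R) (t : {perm 'I_n.+1}) i j : dominant y0 n ->
    (t i < t j)%N = (y0 (t i) < y0 (t j)).
  move=> D0; case: (ltngtP (t i) (t j)) => [ij|ji|->]; last by rewrite ltxx.
    by rewrite (dom_lt D0)// ij -ltnS/=.
  by rewrite ltNge ltW// (dom_lt D0)// ji -ltnS/=.
have ss : s = s'.
  apply: perm_ltn_inj => i j; rewrite (yle y)// (yle y')//.
  by rewrite -(ue i).2 -(ue j).2 -(ve i).2 -(ve j).2; case: (C i j).
have ff : f = f'.
  by apply/ffunP => i; rewrite -(ue i).1 -(ve i).1; exact: alike_sign.
subst s' f'; congr (_, _); apply/eq_in_map => k.
rewrite mem_iota => /andP[_ kn].
have sE (l : nat) : (l < n.+1)%N -> exists j, l = s j.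
  by move=> l_n; exists ((s^-1)%g (Ordinal l_n)); rewrite permKV.
have [j ->] := sE k kn; apply: eq_in_count => p pk /=.
case: p pk => [[i b]|_] /=; last first.
  have [_ _ e] := C j j; rewrite (ue j).2 (ve j).2 /= in e.
  by apply: (eq_lt_iff e); lra.
rewrite mem_idx => ik; have [l ->] := sE i (ltn_trans ik (ltn_ord _)).
have [_ e1 e2] := C l j; rewrite (ue j).2 (ve j).2 (ue l).2 (ve l).2 /= in e1 e2.
by case: b.
Qed.

Lemma has_code_bound u d i : has_code u d -> `|u i| <= n.+1%:R.
Proof.
case=> y [D uE _]; rewrite -/(absf u i) (has_code_abs D uE i).2.
have bnd k : (k <= n)%N -> y k <= k.+1%:R.
  elim: k => [|k IH] kn; first by case: D; lra.
  have [_ _ /(_ k kn) h _ _] := D; have := IH (ltnW kn).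
  by rewrite -[X in _ -> _ <= X]natr1; lra.
apply: (le_trans (bnd (d.1.1 i) _)); first by rewrite -ltnS.
by rewrite ler_nat.
Qed.

(** The member of [J] of least rank either has rank 0, against [y 0 < 1 / 2], or has a predecessor
    outside [J] at distance less than 1. *)
Lemma has_code_no_escape u d J : has_code u d -> ~ escape u J.
Proof.
case=> y [D uE _]; have ue := has_code_abs D uE => -[/set0Pn[i0 i0J] J1 J2].
have [i iJ imin] := arg_minnP (fun i => d.1.1 i : nat) i0J.
have [y0 y02 yS _ _] := D.
have := J1 i iJ; rewrite (ue i).2; case E : (d.1.1 i : nat) => [|k]; first lra.
move=> _; have kn : (k < n)%N by rewrite -ltnS -E ltn_ord.
pose j := ((d.1.1)^-1)%g (inord k).
have jE : d.1.1 j = k :> nat by rewrite permKV inordK// ltnW.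
have jJ : j \notin J.
  by apply/negP => /imin; rewrite jE E ltnn.
by have := J2 i j iJ jJ; rewrite !(ue _).2 E jE; have := yS k kn; lra.
Qed.

(** If the least absolute value exceeds [1 / 2], all coordinates escape; if the gap after rank [k]
    exceeds 1, those of rank above [k] do. Genericity excludes equality. *)
Lemma no_escape_has_code u : generic u -> (forall J, ~ escape u J) ->
  exists d, has_code u d.
Proof.
move=> gu nJ; have ga := generic_abs gu; have [s sE] := rank_perm (generic_inj ga).
(* For [k > n] the index [inord k] is a default; [dominant] inspects [y] only up to [n]. *)
pose y k := absf u ((s^-1)%g (inord k)).
have yE i : y (s i) = absf u i by rewrite /y inord_val permK.
pose c := mkseq (fun k => below y k (y k)) n.+1.
exists (s, [ffun i => u i < 0], c), y; split=> //=; last first.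
  by move=> i; rewrite ffunE yE -numEsign.
have iE k : (k <= n)%N -> s ((s^-1)%g (inord k)) = k :> nat.
  by move=> kn; rewrite permKV inordK.
split.
- exact: absf_gt0.
- rewrite ltNge le_eqVlt negb_or; apply/andP; split.
    apply/eqP => e; have := ga ((s^-1)%g (inord 0)) ((s^-1)%g (inord 0)) false false 1.
    by rewrite /sform !mul1r !inE !eqxx !orbT -!/(y _) -e => /(_ isT isT) /eqP[]; lra.
  apply/negP => h; apply: (nJ setT); split.
  + by apply/set0Pn; exists ord0.
  + move=> i _; rewrite -yE.
    suff : y 0%N <= y (s i) by lra.
    have [->//|si] := posnP (s i).
    by apply/ltW; rewrite yE -sE iE.
  + by move=> i j _; rewrite inE.
- move=> k kn; apply/andP; split.
    by rewrite -sE !iE//; exact: ltnW.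
  rewrite ltNge le_eqVlt negb_or; apply/andP; split.
    apply/eqP => e; have := ga ((s^-1)%g (inord k)) ((s^-1)%g (inord k.+1)) false true (-1).
    rewrite /sform expr0 expr1 mul1r mulN1r !inE eqxx -!/(y _) -e => /(_ isT).
    rewrite (inj_eq perm_inj) -val_eqE /= !inordK ?ltnS ?(ltnW kn)//.
    by rewrite ltn_eqF// => /(_ isT) /eqP[]; lra.
  apply/negP => h; apply: (nJ [set i | (k < s i)%N]).
  have big i : (k < s i)%N -> y k.+1 <= y (s i).
    rewrite leq_eqVlt => /predU1P[<-//|ki]; apply/ltW.
    by rewrite yE -sE iE.
  have small i : (s i <= k)%N -> y (s i) <= y k.
    rewrite leq_eqVlt => /predU1P[<-//|ki]; apply/ltW.
    by rewrite yE -sE iE// ltnW.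
  have yk : 0 < y k by exact: absf_gt0.
  split.
  + by apply/set0Pn; exists ((s^-1)%g (inord k.+1)); rewrite inE iE.
  + by move=> i; rewrite inE => /big; rewrite yE; lra.
  + by move=> i j; rewrite !inE -leqNgt => /big + /small; rewrite !yE; lra.
- move=> i j /andP[ij jn].
  have := ga ((s^-1)%g (inord i)) ((s^-1)%g (inord j)) false false 1.
  by rewrite /sform !mul1r !inE !eqxx !orbT; apply.
- move=> i j /andP[]; rewrite leq_eqVlt => /predU1P[->|ij] jn.
    by apply/eqP; lra.
  apply/eqP => e; have := ga ((s^-1)%g (inord i)) ((s^-1)%g (inord j)) false true (-1).
  rewrite /sform expr0 expr1 mul1r mulN1r !inE eqxx -!/(y _) -e => /(_ isT).
  rewrite (inj_eq perm_inj) -val_eqE /= !inordK ?ltnS ?(leq_trans (ltnW ij))//.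
  by rewrite ltn_eqF// => /(_ isT) /eqP[]; lra.
Qed.

(** With equal signs only [x + y = 1] could meet a level; with opposite signs the three inequations
    exclude the three levels. *)
Lemma signed_sum_neq (x y c : R) (a b : bool) : 0 < x -> 0 < y -> x + y != 1 ->
  (a == b) || [&& x != y, x + 1 != y & y + 1 != x] -> c \in [:: -1; 0; 1] ->
  (-1) ^+ a * x + (-1) ^+ b * y != c.
Proof.
move=> x0 y0 /eqP s1 ab cP; apply/eqP => e.
move: ab cP; rewrite !inE; case: a e; case: b; rewrite ?expr0 ?expr1 ?mul1r ?mulN1r /= => e.
- by move=> _ /or3P[] /eqP cE; try (case: s1; lra); lra.
- by case/and3P => /eqP h1 /eqP h2 /eqP h3 /or3P[] /eqP cE; [case: h3|case: h1|case: h2]; lra.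
- by case/and3P => /eqP h1 /eqP h2 /eqP h3 /or3P[] /eqP cE; [case: h2|case: h1|case: h3]; lra.
- by move=> _ /or3P[] /eqP cE; try (case: s1; lra); lra.
Qed.

Lemma code_has_point (s : {perm 'I_n.+1}) (f : {ffun 'I_n.+1 -> bool}) c :
  c \in all_codes n -> exists2 u : 'I_n.+1 -> R, generic u & has_code u (s, f, c).
Proof.
move=> cP; have cE : c = mkseq (nth 0%N c) n.+1.
  by rewrite -[LHS](mkseq_nth 0%N) (all_codes_size cP).
move: cP; rewrite cE => /mem_all_codes /(@code_realizable R)[y D yc].
pose u i := (-1) ^+ f i * y (s i).
have uE : has_code u (s, f, mkseq (nth 0%N c) n.+1).
  exists y; split=> //=; apply/eq_in_map => k.
  by rewrite mem_iota ltnS => /yc ->.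
exists u => // i j a b c' cP' ab; rewrite sform_abs.
have ue := has_code_abs (d := (s, f, c)) D (fun=> erefl).
set a' := a (+) _; set b' := b (+) _.
have {}ab : (i != j) || (a' == b').
  by rewrite /a' /b'; case: eqVneq ab => [->|]//= /eqP->.
rewrite /sform !(ue _).2 /=.
have sn k : (s k <= n)%N by rewrite -ltnS.
have [y0 _ _ Hs Hd] := D.
have := dom_gt0 D (sn i); have := dom_gt0 D (sn j).
have h1 : y (s i) + y (s j) != 1.
  by case/orP: (leq_total (s i) (s j)) => h; [|rewrite addrC]; rewrite Hs ?h ?sn.
have h2 k l : y (s k) + 1 != y (s l).
  have [h|h] := leqP (s k) (s l); first by rewrite Hd ?h ?sn.
  have {}h : y (s l) < y (s k) by apply: (dom_lt D); apply/andP; split; [|exact: sn].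
  by rewrite gt_eqF//; lra.
have h3 : (i == j) || (y (s i) != y (s j)).
  rewrite -(inj_eq (@perm_inj _ s)) -val_eqE neq_lt /=.
  by case: ltngtP => h //=; apply/orP; [left|right]; apply: (dom_lt D); rewrite h sn.
move=> _ _; apply: signed_sum_neq => //; try by apply: (dom_gt0 D).
by rewrite !h2 !andbT; case: eqVneq ab h3 => /= [_ ->|_ _ ->]; rewrite ?orbT.
Qed.
End SignedPoints.

(* Imported only here because classical sets shadow the finite set notations. *)
From mathcomp Require Import all_boot all_order all_algebra.
From mathcomp Require Import all_classical all_reals all_analysis.
Import Order.TTheory GRing.Theory Num.Theory.
Import numFieldNormedType.Exports.

Local Open Scope classical_set_scope.
Local Open Scope card_scope.

(** * Regions as sign classes *)

Section Component.
Variables (R : realType) (n : nat).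
Implicit Types (A : arrangement R n) (x y : 'rV[R]_n).

Definition dot (v : 'rV[R]_n) x : R := \sum_(k < n) v 0 k * x 0 k.

Lemma dotD v x y : dot v (x + y) = dot v x + dot v y.
Proof. by rewrite -big_split; apply: eq_bigr => k _; rewrite mxE mulrDr. Qed.

Lemma dotZ v a x : dot v (a *: x) = a * dot v x.
Proof. by rewrite mulr_sumr; apply: eq_bigr => k _; rewrite mxE mulrCA. Qed.

Lemma dot_continuous v : continuous (dot v).
Proof.
apply: continuous_big => [|k _ x]; first exact: add_continuous.
apply: (@cvgMl_tmp R _ (nbhs x) _ (fun y : 'rV[R]_n => y 0 k) (v 0 k)).
exact: (@coord_continuous R 1 n 0 k x).
Qed.

Lemma complementP A x :
  complement A x <-> {in A, forall h, dot h.1 x != h.2}.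
Proof.
split=> [nA h hA|hA [h /= /hA]]; last by move/eqP.
by apply/eqP => e; apply: nA; exists h.
Qed.

(** A linear form maps a connected set onto an interval, which cannot jump over an omitted level.
    Conversely, the segment joining two points on the same sides avoids all hyperplanes. *)
Lemma component_sideP A x y : complement A x -> complement A y ->
  connected_component (complement A) x y <->
  {in A, forall h, (dot h.1 x < h.2) = (dot h.1 y < h.2)}.
Proof.
move=> Ax Ay; split=> [[B [Bx BA Bc] By] h hA|side].
  have /connected_intervalP I : connected (dot h.1 @` B).
    apply: connected_continuous_connected Bc _.
    exact/continuous_subspaceT/dot_continuous.
  have out u v : B u -> B v -> dot h.1 u < h.2 -> dot h.1 v < h.2.
    move=> Bu Bv uh; rewrite ltNge; apply/negP => hv.
    have [|z Bz ze] := I _ _ (imageP _ Bu) (imageP _ Bv) h.2; first by rewrite ltW.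
    by have /complementP/(_ h hA)/eqP := BA z Bz.
  by apply/idP/idP; exact: out.
pose g (t : R) := x + t *: (y - x).
have gc : continuous g.
  move=> t; apply: cvgD; first exact: cvg_cst.
  by apply: cvgZr_tmp; exact: cvg_id.
have gseg t : 0 <= t <= 1 -> complement A (g t).
  move=> /andP[t0 t1]; apply/complementP => h hA.
  have := side h hA; move/complementP : Ax => /(_ h hA); move/complementP : Ay => /(_ h hA).
  rewrite dotD dotZ -scaleN1r dotD dotZ.
  move: (dot _ x) (dot _ y) (h.2) => a b c; rewrite !neq_lt mulN1r => bc ac.
  have zab : a <= a + t * (b - a) <= b \/ b <= a + t * (b - a) <= a.
    by case: (leP a b) => ab; [left|right]; nra.
  case: ltP => ca /esym; case: ltP => // cb _; apply/orP; [left|right].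
    by case: zab; lra.
  by case: zab; move: ac bc; rewrite !ltNge ca cb /= -!ltNge; lra.
exists (g @` `[0, 1]).
  split.
  - by exists 0; rewrite /g ?scale0r ?addr0//= in_itv /= lexx ler01.
  - by move=> _ [t /= /[!in_itv]/= t01 <-]; exact: gseg.
  - apply: connected_continuous_connected; last exact: continuous_subspaceT.
    exact/connected_intervalP/interval_is_interval.
exists 1; last by rewrite /g scale1r addrC subrK.
by rewrite /= in_itv /= lexx ler01.
Qed.

End Component.

(** * The arrangement in centered coordinates *)

Section CatalanC.
Variables (R : realType) (n : nat).
Implicit Types (x y : 'rV[R]_n.+1) (i j : 'I_n.+1).
Local Notation A := (catalanC R n.+1).

Definition centered x i : R := x 0 i + 1 / 2.

Lemma dot_unit x i : dot (unit_row R i) x = x 0 i.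
Proof.
rewrite /dot (bigD1 i)//= big1 => [|k ki]; first by rewrite mxE !eqxx mul1r addr0.
by rewrite mxE (negPf ki) andbF mul0r.
Qed.

Lemma dot_addl (v w : 'rV[R]_n.+1) x : dot (v + w) x = dot v x + dot w x.
Proof. by rewrite -big_split; apply: eq_bigr => k _; rewrite mxE mulrDl. Qed.

Lemma dot_scalel a (v : 'rV[R]_n.+1) x : dot (a *: v) x = a * dot v x.
Proof. by rewrite mulr_sumr; apply: eq_bigr => k _; rewrite mxE mulrA. Qed.

(** Equating affine functions rather than zero sets makes the sides agree as well. *)
Definition represents (h : 'rV[R]_n.+1 * R) i j (b : bool) (c : R) : Prop :=
  forall x, dot h.1 x - h.2 = sform (centered x) i j false b - c.

(** Centering adds 1 to [2 x_i] and to [x_i + x_j], turning the levels -2, -1, 0 into -1, 0, 1;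
    differences keep their levels. *)
Lemma catalanC_sform h : h \in A -> exists i j b c,
  [/\ c \in [:: -1; 0; 1], (i != j) || ~~ b & represents h i j b c].
Proof.
rewrite !mem_cat => /or3P[] /allpairsP[[p c] /= [+ cs ->]].
- move=> _; exists p, p, false, (c + 1); split; last 1 first.
  + by move=> x; rewrite /= dot_scalel dot_unit /sform /centered !mul1r; lra.
  + by move: cs; rewrite !inE => /or3P[] /eqP->; apply/or3P;
      [apply: Or31|apply: Or32|apply: Or33]; apply/eqP; lra.
  + by rewrite orbT.
- rewrite mem_filter => /andP[pp _]; exists p.1, p.2, false, (c + 1); split; last 1 first.
  + by move=> x; rewrite /= dot_addl !dot_unit /sform /centered !mul1r; lra.
  + by move: cs; rewrite !inE => /or3P[] /eqP->; apply/or3P;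
      [apply: Or31|apply: Or32|apply: Or33]; apply/eqP; lra.
  + by rewrite orbT.
- rewrite mem_filter => /andP[pp _]; exists p.1, p.2, true, c; split=> //.
  + by rewrite -val_eqE /= ltn_eqF.
  + move=> x; rewrite /= dot_addl -scaleN1r dot_scalel !dot_unit /sform /centered.
    by rewrite expr0 expr1 !mul1r !mulN1r; lra.
Qed.

Lemma sform_catalanC i j (b : bool) c : (i <= j)%N -> (i != j) || ~~ b ->
  c \in [:: -1; 0; 1] -> exists2 h, h \in A & represents h i j b c.
Proof.
move=> ij + cs; have [<-|/negPf nij] := eqVneq i j => /= bP.
  exists (2 *: unit_row R i, c - 1).
    rewrite !mem_cat; apply/or3P/Or31/allpairsP; exists (i, c - 1); split=> //=.
      by rewrite mem_enum.
    move: cs; rewrite !inE => /or3P[] /eqP->; apply/or3P;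
      [apply: Or31|apply: Or32|apply: Or33]; apply/eqP; lra.
  move=> x; rewrite /= dot_scalel dot_unit /sform /centered.
  by case: b bP => // _; rewrite !mul1r; lra.
have lij : (i < j)%N by rewrite ltn_neqAle ij andbT -[_ == _]/(i == j) nij.
case: b {bP}.
  exists (unit_row R i - unit_row R j, c).
    rewrite !mem_cat; apply/or3P/Or33/allpairsP; exists ((i, j), c); split=> //=.
    by rewrite mem_filter mem_enum lij.
  move=> x; rewrite /= dot_addl -scaleN1r dot_scalel !dot_unit /sform /centered.
  by rewrite expr0 expr1 !mul1r !mulN1r; lra.
exists (unit_row R i + unit_row R j, c - 1).
  rewrite !mem_cat; apply/or3P/Or32/allpairsP; exists ((i, j), c - 1); split=> //=.
    by rewrite mem_filter mem_enum lij.
  move: cs; rewrite !inE => /or3P[] /eqP->; apply/or3P;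
    [apply: Or31|apply: Or32|apply: Or33]; apply/eqP; lra.
by move=> x; rewrite /= dot_addl !dot_unit /sform /centered !mul1r; lra.
Qed.

Lemma sform_sym (u : 'I_n.+1 -> R) i j a b : sform u i j a b = sform u j i b a.
Proof. by rewrite /sform addrC. Qed.

Lemma sform_opp (u : 'I_n.+1 -> R) i j a b : sform u i j (~~ a) (~~ b) = - sform u i j a b.
Proof. by rewrite /sform !signrN opprD !mulNr. Qed.

Lemma opp_level (c : R) : (c \in [:: -1; 0; 1]) -> (- c \in [:: -1; 0; 1]).
Proof. by rewrite !inE => /or3P[] /eqP->; rewrite ?opprK ?oppr0 eqxx ?orbT. Qed.

(* Swapping the arguments and changing the overall sign reduces every form to
   one of those occurring in [catalanC]. *)
Lemma sform_reduction (P : 'I_n.+1 -> 'I_n.+1 -> bool -> bool -> Prop) :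
  (forall i j a b, P i j a b -> P j i b a) ->
  (forall i j a b, P i j a b -> P i j (~~ a) (~~ b)) ->
  (forall i j b, (i <= j)%N -> (i != j) || ~~ b -> P i j false b) ->
  forall i j a b, (i != j) || (a == b) -> P i j a b.
Proof.
move=> sym opp base.
have red i j a b : (i <= j)%N -> (i != j) || (a == b) -> P i j a b.
  case: a => ij ab; last by apply: base => //; case: b ab.
  by rewrite -[b]negbK; apply: (opp i j false); apply: base => //; case: b ab.
move=> i j a b ab; case: (leqP i j) => [ij|/ltnW ji]; first exact: red.
by apply: sym; apply: red => //; rewrite eq_sym [b == a]eq_sym.
Qed.

Lemma generic_centeredP x : complement A x <-> generic (centered x).
Proof.
rewrite complementP; split=> [nA|gx h hA]; last first.
  have [i [j [b [c [cP bP e]]]]] := catalanC_sform hA.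
  by rewrite -subr_eq0 e subr_eq0; apply: gx => //; case: b bP {e}.
move=> i j a b c cP ab; move: c cP; apply: (@sform_reduction (fun i j a b =>
    forall c, c \in [:: -1; 0; 1] -> sform (centered x) i j a b != c) _ _ _ i j a b ab).
- by move=> {i j a b ab} i j a b P c; rewrite sform_sym; exact: P.
- move=> {i j a b ab} i j a b P c cP; rewrite sform_opp eqr_oppLR; exact/P/opp_level.
move=> {i j a b ab} i j b ij bP c cP; have [h hA e] := sform_catalanC ij bP cP.
by rewrite -subr_eq0 -e subr_eq0; exact: nA.
Qed.

Lemma alike_centeredP x y : complement A x -> complement A y ->
  connected_component (complement A) x y <-> alike (centered x) (centered y).
Proof.
move=> Ax Ay; rewrite component_sideP//; split=> [side|xy h hA]; last first.
  have [i [j [b [c [cP bP e]]]]] := catalanC_sform hA.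
  by rewrite -subr_lt0 e subr_lt0 xy// -[RHS]subr_lt0 e subr_lt0.
have gx := (generic_centeredP x).1 Ax; have gy := (generic_centeredP y).1 Ay.
move=> i j a b c cP; have [ab|] := boolP ((i != j) || (a == b)); last first.
  rewrite negb_or negbK => /andP[/eqP-> ab]; rewrite /sform.
  by case: a ab; case: b => // _; rewrite expr0 expr1 !mul1r !mulN1r ?subrr ?addNr.
move: c cP; apply: (@sform_reduction (fun i j a b => (i != j) || (a == b) ->
    forall c, c \in [:: -1; 0; 1] ->
      (sform (centered x) i j a b < c) = (sform (centered y) i j a b < c)) _ _ _ i j a b ab ab).
- move=> {i j a b ab} i j a b P ab c cP; rewrite !(sform_sym _ j); apply: P => //.
  by rewrite eq_sym [a == b]eq_sym.
- move=> {i j a b ab} i j a b P ab c cP; rewrite !sform_opp ![- _ < c]ltrNl.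
  have {}ab : (i != j) || (a == b) by case: (i != j) ab => //=; case: (a); case: (b).
  (* Negation reverses the comparison; since neither point lies on a level, the reversed comparisons
     still agree. *)
  have cN := opp_level cP; have := P ab _ cN; have := gx i j a b _ cN ab; have := gy i j a b _ cN ab.
  move: (sform _ i j a b) (sform _ i j a b) => r s; rewrite !neq_lt.
  by move=> /orP[] h /orP[] h'; rewrite ?h ?h' ?[r < _]ltNge ?[s < _]ltNge ?(ltW h) ?(ltW h') //=;
    rewrite !ltNge !ltW.
move=> {i j a b ab} i j b ij bP _ c cP; have [h hA e] := sform_catalanC ij bP cP.
by rewrite -subr_lt0 -e subr_lt0 side// -[LHS]subr_lt0 e subr_lt0.
Qed.

Definition uncentered (u : 'I_n.+1 -> R) : 'rV[R]_n.+1 := \row_i (u i - 1 / 2).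

Lemma uncenteredK u : centered (uncentered u) = u.
Proof. by apply/funext => i; rewrite /centered mxE subrK. Qed.

(** The normals [2 *: unit_row R i] already span, so the intersection in [bounded_region] is the
    whole region. *)
Lemma mem_normal_space x : x \in Defs.normal_space A.
Proof.
have uV i : unit_row R i \in Defs.normal_space A.
  have -> : unit_row R i = 2^-1 *: (2 *: unit_row R i).
    by rewrite scalerA mulVf ?scale1r// pnatr_eq0.
  apply/memvZ/memv_span/mapP; exists (2 *: unit_row R i, 0) => //.
  rewrite !mem_cat; apply/or3P/Or31/allpairsP; exists (i, 0).
  by split=> //=; rewrite ?mem_enum // !inE eqxx !orbT.
by rewrite [x]row_sum_delta; apply: memv_suml => i _; exact: memvZ (uV i).
Qed.

Lemma norm_row_le x (M : R) : 0 <= M -> (`|x| <= M) = [forall i, `|x 0 i| <= M].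
Proof.
move=> M0; rewrite [`|x|]/Num.norm /= mx_normrE; apply/idP/forallP => [/bigmax_leP[_ h] i|h].
  exact: (h (0, i)).
by apply/bigmax_leP; split=> // -[i j] _ /=; rewrite ord1.
Qed.

(** Without a code, some coordinates escape to infinity inside the region. With one, no point of the
    region has an escape set, so each has a code and obeys a uniform bound. *)
Lemma bounded_regionP x : complement A x ->
  bounded_region A (connected_component (complement A) x) <->
  exists d, has_code (centered x) d.
Proof.
move=> Ax; have gx := (generic_centeredP x).1 Ax.
set C := connected_component _ x; split=> [[_ Cb]|[d xd]].
  apply: no_escape_has_code => // J eJ.
  have [M [Mr CM]] := Cb; have {}CM := CM (`|M| + 1).
  have {}CM y : C y -> `|y| <= `|M| + 1.
    move=> Cy; apply: CM => /=; last by split=> //; exact: mem_normal_space.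
    by rewrite (le_lt_trans (ler_norm _))// ltrDl.
  (* The push exceeds the bound [|M| + 1] even after the shift by [1 / 2]. *)
  pose t := `|M| + 2; have M0 : 0 <= `|M| by [].
  have t0 : 0 <= t by rewrite /t; lra.
  pose v := uncentered (push (centered x) J t).
  have gv : complement A v by apply/generic_centeredP; rewrite uncenteredK; exact: push_generic.
  have /CM : C v by apply/alike_centeredP => //; rewrite uncenteredK; exact: push_alike.
  rewrite norm_row_le; last lra.
  have [J0 _ _] := eJ; have /finset.set0Pn[i iJ] := J0; move=> /forallP/(_ i).
  have := (push_abs J i gx t0).2; rewrite iJ /absf => pE.
  have := absf_gt0 i gx; rewrite /absf => p0.
  have : `|push (centered x) J t i| <= `|v 0 i| + 1 / 2.
    rewrite -[push _ _ _]uncenteredK /centered -/v.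
    by apply: le_trans (ler_normD _ _) _; rewrite lerD2l ger0_norm//; lra.
  by rewrite pE /t; lra.
split; first by exists x.
exists n.+2%:R; split=> // M nM y [Cy _].
have M0 : 0 <= M by apply/ltW/(le_lt_trans _ nM).
rewrite /= norm_row_le//; apply/forallP => i.
have Ay : complement A y by exact: connected_component_sub Cy.
have gy := (generic_centeredP y).1 Ay.
have xy : alike (centered x) (centered y) by exact/alike_centeredP.
have [|d' yd] := @no_escape_has_code _ _ (centered y) gy.
  by move=> J /(escape_alike (alike_sym xy)); exact: has_code_no_escape xd.
have := has_code_bound i yd; rewrite /centered => h.
have -> : y 0 i = (y 0 i + 1 / 2) - 1 / 2 by lra.
apply: le_trans (ler_normB _ _) _; rewrite [`|1 / 2|]ger0_norm; last lra.
by move: nM; rewrite -natr1; lra.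
Qed.

End CatalanC.

(** * Counting bounded regions *)

Definition signed_codes n : seq ({perm 'I_n.+1} * {ffun 'I_n.+1 -> bool} * seq nat) :=
  [seq (g, c) | g <- enum {: {perm 'I_n.+1} * {ffun 'I_n.+1 -> bool}}, c <- all_codes n].

Lemma mem_signed_codes n d : (d \in signed_codes n) = (d.2 \in all_codes n).
Proof.
case: d => g c /=; apply/allpairsP/idP => [[[g' c'] /= [_ h [_ ->]]]//|h].
by exists (g, c); rewrite mem_enum.
Qed.

Lemma signed_codes_uniq n : uniq (signed_codes n).
Proof.
apply: allpairs_uniq; [exact: enum_uniq|exact: all_codes_uniq|].
by move=> [? ?] [? ?].
Qed.

Lemma size_signed_codes n :
  size (signed_codes n) = (2 ^ n.+1 * n.+1`! * 'C(2 * n.+1 - 1, n.+1))%N.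
Proof.
rewrite size_allpairs -cardE card_prod card_ffun card_bool card_ord card_Sn.
rewrite size_all_codes [(n.+1`! * _)%N]mulnC; congr (_ * 'C(_, _))%N; lia.
Qed.

Theorem theorem4p15 (R : realType) (n : nat) (hn : (1 <= n)%N) :
  [set C : set 'rV[R]_n | bounded_region (catalanC R n) C]
    #= `I_(2 ^ n * n`! * 'C(2 * n - 1, n))%N.
Proof.
case: n hn => // n _; rewrite -size_signed_codes card_eq_sym.
set A := catalanC R n.+1; set L := signed_codes n.
have pointP d : d \in L -> exists2 x, complement A x & has_code (centered x) d.
  case: d => [[s f] c]; rewrite mem_signed_codes => /(@code_has_point R n s f)[u gu uc].
  by exists (uncentered u); [apply/generic_centeredP|]; rewrite uncenteredK.
have codeL (x : 'rV[R]_n.+1) d : has_code (centered x) d -> d \in L.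
  case=> y [D _ dE]; rewrite mem_signed_codes dE.
  exact/mem_all_codes/below_code.
pose d0 : {perm 'I_n.+1} * {ffun 'I_n.+1 -> bool} * seq nat := (1%g, [ffun=> false], [::]).
pose d k := nth d0 L k.
(* [xget] returns its default only if no point has the code, hence not for [k < size L]. *)
pose pt k := xget 0 [set x | complement A x /\ has_code (centered x) (d k)].
have ptP k : (k < size L)%N -> complement A (pt k) /\ has_code (centered (pt k)) (d k).
  move=> kL; have [x Ax xd] := pointP _ (mem_nth d0 kL).
  exact: (@xgetPex _ 0 [set x | complement A x /\ has_code (centered x) (d k)]
    (ex_intro _ x (conj Ax xd))).
(* Injective because points of one region share their code; surjective because every bounded region
   has a code, which determines it. *)
apply/card_set_bijP; exists (fun k => connected_component (complement A) (pt k)); split.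
- move=> k /= kL; have [Ak kd] := ptP k kL.
  by apply/bounded_regionP => //; exists (d k).
- move=> k l /set_mem/= kL /set_mem/= lL e.
  have [Ak kd] := ptP k kL; have [Al ld] := ptP l lL.
  have kl : alike (centered (pt k)) (centered (pt l)).
    by apply/alike_centeredP => //; rewrite e; exact: connected_component_refl.
  have := alike_has_code ((generic_centeredP _).1 Ak) ((generic_centeredP _).1 Al) kl kd ld.
  by move/eqP; rewrite nth_uniq ?signed_codes_uniq// => /eqP.
- move=> C /= [[x Ax ->] Cb]; have [c xc] :=
    (bounded_regionP Ax).1 (conj (ex_intro2 _ _ x Ax erefl) Cb).
  have cL := codeL _ _ xc; exists (index c L); first by rewrite /= index_mem.
  have [|Ak kd] := ptP (index c L); first by rewrite index_mem.
  rewrite /d nth_index// in kd.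
  apply/esym/same_connected_component/alike_centeredP => //.
  by apply: has_code_alike xc kd; exact/generic_centeredP.
Qed.
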